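(* Let $\mathcal{I}\subset\mathbb{R}$ be an open interval and let $\Phi:\mathcal{I}\to\mathbb{R}$ be smooth and convex with $\Phi''$ convex on $\mathcal{I}$. Let $p\in[0,1]$ and $q:=1-p$. Then, for any $f:\{0,1\}\to\mathcal{I}$, $$\mathbf{Ent}_{\mathcal{B}(1,p)}^{\Phi}(f)\leq pq\,\mathbf{E}_{\mathcal{B}(1,p)}\big(A^\Phi(f,\mathrm{D}f)\big),$$ where $\mathrm{D}f(x):=f(x+1)-f(x)$ with addition $x+1$ taken modulo $2$. Moreover, the inequality becomes an equality when $\Phi(u)=u^2$ on $\mathcal{I}=\mathbb{R}$.
   Context: $\mathcal{B}(1,p)=q\delta_0+p\delta_1$ is the Bernoulli law on $\{0,1\}$, identified with $\mathbb{Z}/2\mathbb{Z}$. $\mathbf{E}_Q(f)$ is the mean of $f$ under $Q$ and $\mathbf{Ent}_Q^\Phi(f):=\mathbf{E}_Q(\Phi(f))-\Phi(\mathbf{E}_Qf)$. For $u,u+v\in\mathcal{I}$, $A^\Phi(u,v):=\Phi(u+v)-\Phi(u)-\Phi'(u)v$, and $A^\Phi(f,\mathrm{D}f)$ is the function $x\mapsto A^\Phi(f(x),\mathrm{D}f(x))$ on $\{0,1\}$. *)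

(* Defs.v *)
From HB Require Import structures.
From mathcomp Require Import all_boot all_order all_algebra.
From mathcomp Require Import all_classical all_reals all_analysis.

Set Implicit Arguments.
Unset Strict Implicit.
Unset Printing Implicit Defensive.

Import Order.TTheory GRing.Theory Num.Theory.
Import numFieldNormedType.Exports.

Local Open Scope classical_set_scope.
Local Open Scope ring_scope.

(* A function on an open interval [I] is represented by a total function
   [R -> R] whose values outside [I] are left unconstrained.  Since [I] is
   open, its iterated derivatives at points of [I] do not depend on them. *)
Definition smooth_on (R : realType) (I : set R) (Phi : R -> R) : Prop :=
  forall (n : nat) (x : R), I x -> derivable (derive1n n Phi) x 1.

(* The first term may be infinite for a general [Q], hence the codomain. *)
Definition Ent d (T : measurableType d) (R : realType) (Q : probability T R)
    (Phi : R -> R) (f : T -> R) : \bar R :=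
  ('E_Q[Phi \o f] - (Phi (fine 'E_Q[f]))%:E)%E.

Definition Aphi (R : realType) (Phi : R -> R) (u v : R) : R :=
  Phi (u + v) - Phi u - derive1 Phi u * v.

(* [bool] plays the role of {0,1} = Z/2Z: its library ring structure has
   addition [addb] and unit [true], so [x + 1] is addition modulo 2. *)
Definition discD (R : realType) (f : bool -> R) (x : bool) : R :=
  f (x + 1) - f x.

(* Main.v *)
(* Write a = f(0), b = f(1).  As a function of p, the right-hand side minus the
   entropy is H(p) = Phi((1-p)a + pb) - P(p), where P is the cubic with
   P = phi and P' = phi' at 0 and 1 for phi(t) = Phi(a + t(b-a)) (Hermite
   interpolation).  Thus H and H' vanish at 0 and 1, while H'' is convex, being
   the convex function phi'' minus an affine one; this forces H >= 0. *)
Require Import Defs.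
From HB Require Import structures.
From mathcomp Require Import all_boot all_order all_algebra.
From mathcomp Require Import all_classical all_reals all_analysis.
From mathcomp Require Import ring lra.

Set Implicit Arguments.
Unset Strict Implicit.
Unset Printing Implicit Defensive.

Import Order.TTheory GRing.Theory Num.Theory.
Import numFieldNormedType.Exports.

Local Open Scope classical_set_scope.
Local Open Scope ring_scope.

Lemma expectation_bernoulli (R : realType) (p : R) (hp : 0 <= p <= 1)
    (f : bool -> R) :
  'E_(bernoulli_prob p)[f]%E = ((1 - p) * f false + p * f true)%:E.
Proof.
rewrite unlock integralE !integral_bernoulli_prob//.
rewrite !funeposE !funenegE /unstable.onem -!EFinN -!EFin_max -!EFinM -!EFinD.
congr EFin.
(* The integral is defined through positive and negative parts; this identity glues them back
   together at each atom. *)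
have posneg (x : R) : Num.max x 0 - Num.max (- x) 0 = x.
  by rewrite /Num.max; case: ifPn; case: ifPn; lra.
by rewrite -[in RHS](posneg (f true)) -[in RHS](posneg (f false)); ring.
Qed.

Lemma Ent_bernoulli (R : realType) (p : R) (hp : 0 <= p <= 1)
    (Phi : R -> R) (f : bool -> R) :
  Ent (bernoulli_prob p) Phi f =
  ((1 - p) * Phi (f false) + p * Phi (f true)
   - Phi ((1 - p) * f false + p * f true))%:E.
Proof. by rewrite /Ent !expectation_bernoulli. Qed.

Lemma expectation_Aphi_bernoulli (R : realType) (p : R) (hp : 0 <= p <= 1)
    (Phi : R -> R) (f : bool -> R) :
  'E_(bernoulli_prob p)[fun x => Aphi Phi (f x) (discD f x)]%E =
  ((1 - p) * (Phi (f true) - Phi (f false)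
              - derive1 Phi (f false) * (f true - f false))
   + p * (Phi (f false) - Phi (f true)
          - derive1 Phi (f true) * (f false - f true)))%:E.
Proof.
rewrite expectation_bernoulli// /Aphi /discD.
rewrite (_ : false + 1 = true)// (_ : true + 1 = false)//.
by rewrite ![f _ + (f _ - f _)]addrC !subrK.
Qed.

(** Differentiability up to the endpoints yields the continuity that [MVT] asks for, so a single
    hypothesis suffices. *)
Lemma MVT_derive (R : realType) (f df : R -> R) (a b : R) :
  a < b -> (forall x, a <= x <= b -> is_derive x 1 f (df x)) ->
  exists2 c, a < c < b & f b - f a = df c * (b - a).
Proof.
move=> ab fdf.
have [x xab||c] := @MVT R f df a b ab.
- by apply: fdf; move: xab; rewrite in_itv/= => /andP[? ?]; rewrite !ltW.
- apply: derivable_within_continuous => x; rewrite in_itv/= => xab.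
  by have [] := fdf _ xab.
- by rewrite in_itv/= => ? ?; exists c.
Qed.

(* If H x < 0, the mean value theorem on [a, x] and [x, b], together with
   dH a = dH b = 0, forces d2H to take the signs -, +, - at three increasing
   points, which convexity forbids. *)
Lemma convex_derive2_ge0 (R : realType) (H dH d2H : R -> R) (a b : R) :
  (forall x, a <= x <= b -> is_derive x 1 H (dH x)) ->
  (forall x, a <= x <= b -> is_derive x 1 dH (d2H x)) ->
  (forall s x y, 0 <= s <= 1 -> a <= x <= b -> a <= y <= b ->
    d2H (s * x + (1 - s) * y) <= s * d2H x + (1 - s) * d2H y) ->
  H a = 0 -> H b = 0 -> dH a = 0 -> dH b = 0 ->
  forall x, a <= x <= b -> 0 <= H x.
Proof.
move=> HdH dHd2H d2H_convex Ha Hb dHa dHb x /andP[ax xb].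
rewrite leNgt; apply/negP => Hx_lt0.
have lt_ax : a < x by rewrite lt_neqAle ax andbT; apply: contraTneq Hx_lt0
  => <-; rewrite Ha ltxx.
have lt_xb : x < b by rewrite lt_neqAle xb andbT; apply: contraTneq Hx_lt0
  => ->; rewrite Hb ltxx.
have [|c1 /andP[ac1 c1x] Hc1] := MVT_derive lt_ax (df := dH) (f := H).
  by move=> y /andP[? ?]; apply: HdH; lra.
have [|c2 /andP[xc2 c2b] Hc2] := MVT_derive lt_xb (df := dH) (f := H).
  by move=> y /andP[? ?]; apply: HdH; lra.
have dH_c1 : dH c1 < 0 by nra.
have dH_c2 : 0 < dH c2 by nra.
have c1c2 : c1 < c2 by lra.
have [|y1 /andP[? ?] Hy1] := MVT_derive ac1 (df := d2H) (f := dH).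
  by move=> y /andP[? ?]; apply: dHd2H; lra.
have [|y2 /andP[? ?] Hy2] := MVT_derive c1c2 (df := d2H) (f := dH).
  by move=> y /andP[? ?]; apply: dHd2H; lra.
have [|y3 /andP[? ?] Hy3] := MVT_derive c2b (df := d2H) (f := dH).
  by move=> y /andP[? ?]; apply: dHd2H; lra.
have d2H_y1 : d2H y1 < 0 by nra.
have d2H_y2 : 0 < d2H y2 by nra.
have d2H_y3 : d2H y3 < 0 by nra.
have y13 : 0 < y3 - y1 by lra.
(* The weight that makes [y2] a convex combination of [y1] and [y3]: convexity then bounds the
   positive [d2H y2] by an average of two negative values. *)
pose s := (y3 - y2) / (y3 - y1).
have s0 : 0 <= s by rewrite divr_ge0; lra.
have s1 : s <= 1 by rewrite ler_pdivrMr//; lra.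
have y2E : s * y1 + (1 - s) * y3 = y2 by rewrite /s; field; lra.
have := d2H_convex s y1 y3.
by rewrite y2E => /(_ ltac:(lra) ltac:(lra) ltac:(lra)); nra.
Qed.

Lemma convex_functionP (R : realType) (I : set R) (f : R -> R) :
  convex_function I f ->
  forall s x y, 0 <= s <= 1 -> I x -> I y ->
    f (s * x + (1 - s) * y) <= s * f x + (1 - s) * f y.
Proof.
move=> fconv s x y /andP[s0 s1] Ix Iy.
by have := fconv (Itv01 s0 s1) x y (mem_set Ix) (mem_set Iy).
Qed.

Lemma is_derive_comp_line (R : realType) (f : R -> R) (a d t : R) :
  derivable f (a + t * d) 1 ->
  is_derive t 1 (fun s : R => f (a + s * d)) (d * derive1 f (a + t * d)).
Proof.
move=> df.
have dline : is_derive t (1 : R) (fun s : R => a + s * d) d.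
  by apply: is_derive_eq; rewrite /GRing.scale/=; ring.
have dfl : is_derive (a + t * d) (1 : R) f (derive1 f (a + t * d)).
  by rewrite derive1E; apply: derivableP.
have := @is_derive1_comp R f (fun s : R => a + s * d) t _ _ dfl dline.
by move=> h; apply: is_derive_eq; rewrite /GRing.scale/= mulrC.
Qed.

(** This is what the inequality becomes once the Bernoulli expectations are computed, with [a] and
    [b] the two values of [f]. *)
Lemma entropy_two_point (R : realType) (I : set R) (Phi : R -> R) (a b p : R) :
  0 <= p <= 1 -> is_interval I -> smooth_on I Phi ->
  convex_function I (derive1n 2 Phi) -> I a -> I b ->
  (1 - p) * Phi a + p * Phi b - Phi ((1 - p) * a + p * b) <=
  p * (1 - p) * ((1 - p) * (Phi b - Phi a - derive1 Phi a * (b - a))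
                 + p * (Phi a - Phi b - derive1 Phi b * (a - b))).
Proof.
move=> hp Iitv smoothPhi /convex_functionP convPhi2 Ia Ib.
set A := Phi b - _ - _; set B := Phi a - _ - _.
pose d := b - a.
(* The sign of [d] is not known, hence the two cases. *)
have Iline t : 0 <= t <= 1 -> I (a + t * d).
  move=> /andP[t0 t1]; have [ab|ba] := leP a b.
    by apply: (Iitv _ _ Ia Ib); rewrite /d; apply/andP; split; nra.
  by apply: (Iitv _ _ Ib Ia); rewrite /d; apply/andP; split; nra.
(* The subtracted term is the Hermite cubic: the chord meets the endpoint values, and the correction
   in [t * (1 - t)] changes its slope by [- A] at 0 and by [B] at 1, which gives [d * derive1 Phi a]
   and [d * derive1 Phi b]. *)
pose H (t : R) := Phi (a + t * d)
  - ((1 - t) * Phi a + t * Phi b - t * (1 - t) * ((1 - t) * A + t * B)).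
pose dH (t : R) := d * derive1 Phi (a + t * d)
  + Phi a - Phi b + (1 - 2 * t) * ((1 - t) * A + t * B) + t * (1 - t) * (B - A).
pose d2H (t : R) := d ^+ 2 * derive1n 2 Phi (a + t * d)
  - 2 * ((1 - t) * A + t * B) + 2 * (1 - 2 * t) * (B - A).
have ad : a + 1 * d = b by rewrite /d; ring.
suff : 0 <= H p.
  rewrite /H (_ : a + p * d = (1 - p) * a + p * b); last by rewrite /d; ring.
  by lra.
apply: (@convex_derive2_ge0 R H dH d2H 0 1) => //.
- move=> t /Iline /(smoothPhi 0%N) /is_derive_comp_line dphi.
  by apply: is_derive_eq; rewrite /dH /GRing.scale/=; ring.
- move=> t /Iline /(smoothPhi 1%N) /is_derive_comp_line dphi.
  rewrite /= in dphi.
  by apply: is_derive_eq; rewrite /d2H /GRing.scale/=; ring.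
(* The terms of [d2H] in [A] and [B] are affine in [t], so they contribute equally to both sides;
   only the multiple of the second derivative by [d ^+ 2] matters. *)
- move=> s x y hs hx hy.
  have := convPhi2 s _ _ hs (Iline _ hx) (Iline _ hy).
  rewrite (_ : s * (a + x * d) + (1 - s) * (a + y * d)
    = a + (s * x + (1 - s) * y) * d); last by ring.
  move=> /(ler_wpM2l (sqr_ge0 d)); rewrite /d2H; lra.
- by rewrite /H mul0r addr0; ring.
- by rewrite /H ad; ring.
- by rewrite /dH /A /d mul0r addr0; ring.
- by rewrite /dH ad /B /d; ring.
Qed.

Theorem lemma2p2 (R : realType) (p : R) (hp : 0 <= p <= 1) :
  (forall (I : set R) (Phi : R -> R),
     open I -> is_interval I ->
     smooth_on I Phi -> convex_function I Phi ->
     convex_function I (derive1n 2 Phi) ->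
     forall f : bool -> R, (forall x, I (f x)) ->
     (Ent (bernoulli_prob p) Phi f <=
      (p * (1 - p))%:E *
        'E_(bernoulli_prob p)[fun x => Aphi Phi (f x) (discD f x)])%E) /\
  (forall f : bool -> R,
     let Phi := fun u : R => u ^+ 2 in
     Ent (bernoulli_prob p) Phi f =
     ((p * (1 - p))%:E *
        'E_(bernoulli_prob p)[fun x => Aphi Phi (f x) (discD f x)])%E).
Proof.
split=> [I Phi _ Iitv smoothPhi _ convPhi2 f If|f Phi].
  rewrite Ent_bernoulli// expectation_Aphi_bernoulli// -EFinM lee_fin.
  exact: (entropy_two_point hp Iitv).
rewrite Ent_bernoulli// expectation_Aphi_bernoulli// -EFinM; congr EFin.
(* For the square, both values of [Aphi] equal [(f true - f false) ^+ 2], and both sides are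
   [p * (1 - p)] times it. *)
have dPhi x : derive1 Phi x = 2 * x.
  by rewrite derive1E /Phi derive_val /GRing.scale/=; ring.
by rewrite !dPhi /Phi; ring.
Qed.
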